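(* For every integer $k\ge 2$, the Mycielski graph $M_k$ of order $k$ satisfies $\varphi(M_k) = \hat{\varphi}(M_k) = k-2$.
   Context: All graphs are finite, simple and undirected, with at least one vertex. $\chi$ denotes the chromatic number. For a proper vertex coloring $c$ of $G$ and an induced subgraph $H$ of $G$, let $c(H)$ be the set of colors used by $c$ on the vertices of $H$. Define $\varphi_c(G)=\max_{H}\,(|c(H)|-\chi(H))$ over all induced subgraphs $H$ of $G$, and $\hat{\varphi}_c(G)$ as the same maximum taken only over all connected induced subgraphs $H$ of $G$. Define $\varphi(G)=\min_c \varphi_c(G)$ and $\hat{\varphi}(G)=\min_c \hat{\varphi}_c(G)$, the minima over all proper colorings $c$ of $G$ (with any number of colors). For a graph $G$ with vertex set $\{v_1,\ldots,v_n\}$, the Mycielskian $M(G)$ has vertex set $\{v_1,\ldots,v_n\}\cup\{u_1,\ldots,u_n\}\cup\{w\}$ ($2n+1$ distinct vertices) and edge set consisting of (i) all edges of $G$, (ii) the edge $(w,u_i)$ for each $i$, and (iii) the two edges $(v_i,u_j)$ and $(v_j,u_i)$ for each edge $(v_i,v_j)$ of $G$. The Mycielski graphs are defined by $M_2=K_2$ and $M_k=M(M_{k-1})$ for $k\ge 3$. *)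

(* Defs.v *)
From mathcomp Require Import all_boot.
From mathcomp Require Import boolp.

Set Implicit Arguments.
Unset Strict Implicit.
Unset Printing Implicit Defensive.

(* Finite simple undirected graphs. The null graph is allowed by the type;
   it is excluded below wherever a maximum ranges over subgraphs. *)
Record sgraph := SGraph {
  vertex :> finType;
  adj : rel vertex;
  adj_sym : symmetric adj;
  adj_irr : irreflexive adj }.

Definition proper_coloring (G : sgraph) (C : eqType) (c : G -> C) : bool :=
  [forall x : G, forall y : G, adj x y ==> (c x != c y)].

Lemma proper_coloringP (G : sgraph) (C : eqType) (c : G -> C) :
  reflect (forall x y : G, adj x y -> c x != c y) (proper_coloring c).
Proof.
apply: (iffP forallP) => [h x y xy | h x].
  by have /forallP/(_ y)/implyP := h x; apply.
by apply/forallP => y; apply/implyP; apply: h.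
Qed.

Lemma proper_enum_rank (G : sgraph) : proper_coloring (@enum_rank G).
Proof.
apply/proper_coloringP => x y xy; rewrite (inj_eq enum_rank_inj).
by apply: contraTneq xy => ->; rewrite adj_irr.
Qed.

Definition colorable (G : sgraph) (n : nat) : bool :=
  [exists c : {ffun G -> 'I_n}, proper_coloring c].

Lemma ex_colorable (G : sgraph) : exists n, colorable G n.
Proof.
exists #|G|; apply/existsP; exists [ffun x => enum_rank x].
apply/proper_coloringP => x y xy; rewrite !ffunE.
exact: (proper_coloringP _ (proper_enum_rank G)).
Qed.

Definition chi (G : sgraph) : nat := ex_minn (ex_colorable G).

Section Induced.
Variables (G : sgraph) (S : {set G}).

Definition induced_adj : rel {x : G | x \in S} :=
  fun x y => adj (val x) (val y).

Lemma induced_sym : symmetric induced_adj.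
Proof. by move=> x y; rewrite /induced_adj adj_sym. Qed.

Lemma induced_irr : irreflexive induced_adj.
Proof. by move=> x; rewrite /induced_adj adj_irr. Qed.

Definition induced : sgraph := SGraph induced_sym induced_irr.

End Induced.

Definition connected_graph (G : sgraph) : bool :=
  (0 < #|G|) && [forall x : G, forall y : G, connect (@adj G) x y].

Definition num_colors (G : sgraph) (c : G -> nat) (S : {set G}) : nat :=
  size (undup [seq c x | x in S]).

(* The truncated subtractions in [phi_col] and [phihat_col] are exact. *)
Lemma chi_le_num_colors (G : sgraph) (c : G -> nat) (S : {set G}) :
  proper_coloring c -> chi (induced S) <= num_colors c S.
Proof.
move=> /proper_coloringP cP; rewrite /chi; case: ex_minnP => m _; apply.
set s := undup [seq c x | x in S].
have cs (x : induced S) : c (val x) \in s.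
  by rewrite mem_undup; apply: image_f; apply: valP.
have lt (x : induced S) : index (c (val x)) s < num_colors c S.
  by rewrite index_mem.
apply/existsP; exists [ffun x => Ordinal (lt x)].
apply/proper_coloringP => x y xy; rewrite !ffunE -val_eqE /=.
apply: contraNneq (cP _ _ xy) => e.
by rewrite -(nth_index 0 (cs x)) e (nth_index 0 (cs y)).
Qed.

Definition phi_col (G : sgraph) (c : G -> nat) : nat :=
  \max_(S : {set G} | S != set0) (num_colors c S - chi (induced S)).

Definition phihat_col (G : sgraph) (c : G -> nat) : nat :=
  \max_(S : {set G} | connected_graph (induced S))
    (num_colors c S - chi (induced S)).

Lemma ex_proper_value (G : sgraph) (f : (G -> nat) -> nat) :
  exists m, `[< exists2 c : G -> nat, proper_coloring c & f c = m >].
Proof.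
pose c (x : G) : nat := nat_of_ord (enum_rank x).
exists (f c); apply/asboolP; exists c => //.
apply/proper_coloringP => x y xy; rewrite /c val_eqE.
exact: (proper_coloringP _ (proper_enum_rank G)).
Qed.

Definition min_proper (G : sgraph) (f : (G -> nat) -> nat) : nat :=
  ex_minn (ex_proper_value f).

Definition phi (G : sgraph) : nat := min_proper (@phi_col G).

Definition phihat (G : sgraph) : nat := min_proper (@phihat_col G).

Section Complete.
Variable n : nat.

Definition complete_adj : rel 'I_n := fun x y => x != y.

Lemma complete_sym : symmetric complete_adj.
Proof. by move=> x y; rewrite /complete_adj eq_sym. Qed.

Lemma complete_irr : irreflexive complete_adj.
Proof. by move=> x; rewrite /complete_adj eqxx. Qed.

Definition complete_graph : sgraph := SGraph complete_sym complete_irr.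

End Complete.

Section Mycielskian.
Variable G : sgraph.

(* [Some (inl i)] is v_i, [Some (inr i)] is u_i and [None] is w. *)
Definition mycielskian_adj : rel (option (G + G)) := fun x y =>
  match x, y with
  | Some (inl i), Some (inl j) => adj i j
  | Some (inl i), Some (inr j) => adj i j
  | Some (inr i), Some (inl j) => adj i j
  | Some (inr _), None | None, Some (inr _) => true
  | _, _ => false
  end.

Lemma mycielskian_sym : symmetric mycielskian_adj.
Proof. by move=> [[i|i]|] [[j|j]|] //=; rewrite adj_sym. Qed.

Lemma mycielskian_irr : irreflexive mycielskian_adj.
Proof. by move=> [[i|i]|] //=; rewrite adj_irr. Qed.

Definition mycielskian : sgraph := SGraph mycielskian_sym mycielskian_irr.

End Mycielskian.

(* Only meaningful for k >= 2. *)
Definition mycielski_graph (k : nat) : sgraph :=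
  iter (k - 2) mycielskian (complete_graph 2).

(* Main.v *)
Require Import Defs.
From mathcomp Require Import all_boot.
From mathcomp Require Import boolp.

Set Implicit Arguments.
Unset Strict Implicit.
Unset Printing Implicit Defensive.

(** Upper bound: in the standard [k]-coloring of [M_k], where [u_i] copies the
   color of [v_i] and [w] gets a new color, no independent set sees all [k]
   colors, since one containing [w] contains no [u_i] and induction applies to
   its [v_i]; every other induced subgraph has chromatic number at least 2.

   Lower bound: every proper coloring [c] of [M_k] has a connected bipartite
   induced subgraph with at least [k] colors.  Given [c] on [M(G)], recolor
   [v_i] with [c(u_i)] whenever [c(v_i) = c(w)]; this is a proper coloring of
   [G] avoiding [c(w)], so induction gives a subgraph [H] of [G] with [k-1]
   colors, none of them [c(w)].  If some vertices of [H] were recolored, add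
   their twins [u_i] to [H]; otherwise add one twin and [w].  A twin preserves
   connectedness and bipartiteness, and a pendant vertex does too. *)

(** * Bounds on [min_proper], [chi] and [num_colors] *)

Lemma min_proper_le (G : sgraph) (f : (G -> nat) -> nat) (c : G -> nat) :
  proper_coloring c -> min_proper f <= f c.
Proof.
move=> cP; rewrite /min_proper; case: ex_minnP => m _; apply.
by apply/asboolP; exists c.
Qed.

Lemma min_proper_ge (G : sgraph) (f : (G -> nat) -> nat) (m : nat) :
  (forall c : G -> nat, proper_coloring c -> m <= f c) -> m <= min_proper f.
Proof.
move=> fm; rewrite /min_proper; case: ex_minnP => n /asboolP[c cP <-] _.
exact: fm.
Qed.

Lemma chi_le (G : sgraph) (n : nat) : colorable G n -> chi G <= n.
Proof. by rewrite /chi; case: ex_minnP => m _; apply. Qed.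

Lemma colorable_chi (G : sgraph) : colorable G (chi G).
Proof. by rewrite /chi; case: ex_minnP. Qed.

Lemma chi_gt0 (G : sgraph) (x : G) : 0 < chi G.
Proof.
by have /existsP[c _] := colorable_chi G; apply: leq_ltn_trans (ltn_ord (c x)).
Qed.

Lemma chi_gt1 (G : sgraph) (x y : G) : adj x y -> 1 < chi G.
Proof.
move=> xy; have /existsP[c /proper_coloringP/(_ _ _ xy)] := colorable_chi G.
move: (c x) (c y); case: (chi G) => [|[|n]] //; first by case.
by move=> a b; rewrite !ord1.
Qed.

Lemma phihat_le_phi (G : sgraph) : phihat G <= phi G.
Proof.
apply: min_proper_ge => c cP; apply: leq_trans (min_proper_le _ cP) _.
apply/bigmax_leqP => S /andP[/card_gt0P[x _] _].
apply: (@leq_bigmax_cond _ _ (fun S => num_colors c S - chi (induced S))).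
by apply/set0Pn; exists (val x); apply: valP.
Qed.

Lemma num_colors_ge (G : sgraph) (c : G -> nat) (S : {set G}) (s : seq nat) :
  uniq s -> (forall a, a \in s -> exists2 x, x \in S & c x = a) ->
  size s <= num_colors c S.
Proof.
move=> us sP; apply: uniq_leq_size => // a /sP[x xS <-].
by rewrite mem_undup image_f.
Qed.

Lemma num_colors_le (G : sgraph) (c : G -> nat) (S : {set G}) (s : seq nat) :
  (forall x, x \in S -> c x \in s) -> num_colors c S <= size s.
Proof.
move=> sP; apply: uniq_leq_size (undup_uniq _) _ => a.
by rewrite mem_undup => /imageP[x xS ->]; apply: sP.
Qed.

(** * Upper bound: colorings in which independent sets miss a color *)

Definition independent (G : sgraph) (S : {set G}) : Prop :=
  {in S &, forall x y, ~~ adj x y}.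

(** The missed color [a] may depend on [S]. The last clause is aimed at the subgraphs of chromatic
    number 1, where [k] colors would give an excess of [k - 1]. *)
Definition tight_coloring (G : sgraph) (k : nat) (c : G -> nat) : Prop :=
  [/\ proper_coloring c, forall x, c x < k &
      forall S : {set G}, independent S ->
        exists2 a, a < k & forall x, x \in S -> c x != a].

Lemma phi_le_tight (G : sgraph) (k : nat) (c : G -> nat) :
  tight_coloring k c -> phi G <= k - 2.
Proof.
case=> cP ck indep; apply: leq_trans (min_proper_le _ cP) _.
apply/bigmax_leqP => S /set0Pn[x0 x0S].
have leSk : num_colors c S <= k.
  rewrite -[leqRHS](size_iota 0 k); apply: num_colors_le => x _.
  by rewrite mem_iota /=.
have [chi2|chi1] := leqP 2 (chi (induced S)); first exact: leq_sub.
have chi_pos : 0 < chi (induced S).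
  by apply: (@chi_gt0 (induced S)); exists x0.
have /indep[a ak Sa] : independent S.
  move=> x y xS yS; apply: contraL chi1 => xy; rewrite -leqNgt.
  pose u : induced S := exist _ x xS; pose v : induced S := exist _ y yS.
  exact: (@chi_gt1 _ u v).
have leSk1 : num_colors c S <= k.-1.
  have -> : k.-1 = size (rem a (iota 0 k)).
    by rewrite size_rem ?mem_iota // size_iota.
  apply: num_colors_le => x xS.
  by rewrite mem_rem_uniq ?iota_uniq // inE Sa //= mem_iota /=.
by apply: leq_trans (leq_sub leSk1 chi_pos) _; rewrite -subn1 -subnDA.
Qed.

Definition mycielskian_coloring (G : sgraph) (k : nat) (c : G -> nat)
    (z : mycielskian G) : nat :=
  match z with Some (inl i) | Some (inr i) => c i | None => k end.

Lemma mycielskian_tight (G : sgraph) (k : nat) (c : G -> nat) :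
  tight_coloring k c -> tight_coloring k.+1 (mycielskian_coloring k c).
Proof.
case=> /proper_coloringP cP ck indep; split.
- apply/proper_coloringP => [[[i|i]|]] [[j|j]|] //=; try exact: cP.
    by rewrite neq_ltn ck.
  by rewrite neq_ltn ck orbT.
- by case=> [[i|i]|] //=; apply: ltnW; rewrite ltnS.
(* Only [None] has color [k], so a set without it misses [k]. *)
- move=> S Sind; have [wS|wNS] := boolP (None \in S); last first.
    exists k => // -[[i|i]|] /= zS; [by rewrite neq_ltn ck..|].
    by rewrite zS in wNS.
  have /indep[a ak Sa] : independent [set i : G | Some (inl i) \in S].
    by move=> i j; rewrite !inE => iS jS; apply: (Sind _ _ iS jS).
  exists a; first exact: ltnW.
  move=> [[i|i]|] /= zS; first by apply: Sa; rewrite inE.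
    by have := Sind _ _ zS wS.
  by rewrite neq_ltn ak orbT.
Qed.

Lemma mycielski_graph_tight (n : nat) :
  exists c, tight_coloring n.+2 (c : mycielski_graph n.+2 -> nat).
Proof.
rewrite /mycielski_graph !subSS subn0; elim: n => [|n [c cP]]; last first.
  by exists (mycielskian_coloring n.+2 c); apply: mycielskian_tight.
exists (fun x : 'I_2 => x : nat); split; first exact/proper_coloringP.
  by move=> x; apply: ltn_ord.
move=> S Sind; have [S0|] := boolP (ord0 \in S).
  exists 1 => // x xS; have := Sind _ _ S0 xS.
  by rewrite negbK => /eqP <-.
by move=> S0; exists 0 => // x; apply: contraTneq => /(@val_inj _ _ _ x ord0) ->.
Qed.

(** * Lower bound: connected bipartite subgraphs with many colors *)

(* Connectedness is expressed as an induction principle from a root, and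
   the bipartition is a boolean coloring of the whole vertex set. *)
Definition connected_bipartite (G : sgraph) (S : {set G}) : Prop :=
  exists (b : G -> bool) (r : G),
  [/\ r \in S, {in S &, forall x y, adj x y -> b x != b y},
      {in S, forall x, exists2 y, y \in S & adj x y} &
      forall A : G -> Prop, A r ->
        {in S &, forall x y, A x -> adj x y -> A y} -> {in S, forall x, A x}].

Lemma connected_bipartite_connected (G : sgraph) (S : {set G}) :
  connected_bipartite S -> connected_graph (induced S).
Proof.
case=> b [r [rS _ _ ind]]; pose r' : induced S := exist _ r rS.
have cr (x : induced S) : connect (@adj (induced S)) r' x.
  (* [A] is reachability from the root, transported to [G], where [ind] applies, through a preimage
     in the subtype. *)
  pose A y := exists2 z : induced S, val z = y
                                   & connect (@adj (induced S)) r' z.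
  have [||z /val_inj <- //] := ind A _ _ (val x) (valP x).
    by exists r'.
  move=> y z yS zS [u uy ru] yz; pose v : induced S := exist _ z zS.
  exists v => //; apply: connect_trans ru (connect1 _).
  by rewrite /= /induced_adj uy.
apply/andP; split; first by apply/card_gt0P; exists r'.
apply/forallP => x; apply/forallP => y; apply: connect_trans (cr y).
by rewrite (sym_connect_sym (@adj_sym (induced S))) ?cr.
Qed.

Lemma connected_bipartite_chi (G : sgraph) (S : {set G}) :
  connected_bipartite S -> chi (induced S) <= 2.
Proof.
case=> b [r [_ bP _ _]]; apply: chi_le; apply/existsP.
exists [ffun x => inord (b (val x))]; apply/proper_coloringP => x y xy.
have := bP _ _ (valP x) (valP y) xy; rewrite !ffunE -val_eqE /=.
by rewrite !inordK; case: (b (val x)); case: (b (val y)).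
Qed.

Section TwinExtension.
Variables (G : sgraph) (S Y : {set G}) (addw : bool).

Definition twin_extension : {set mycielskian G} :=
  [set z : mycielskian G | match z with
    | Some (inl i) => i \in S
    | Some (inr i) => i \in Y
    | None => addw
    end].

(** The twin of [i] goes on the side of [i]: its neighbors in [S] are those of [i], and twins are
    pairwise nonadjacent. Since [w] is adjacent to all twins, which may lie on both sides, it is
    added only when there is exactly one, as a pendant vertex. *)
Lemma twin_extension_connected_bipartite :
  connected_bipartite S -> Y \subset S -> (addw -> exists i, Y = [set i]) ->
  connected_bipartite twin_extension.
Proof.
case=> b [r [rS bP nbr ind]] /subsetP YS wY.
(* The side of [w], opposite to that of its only twin; meaningful when [addw] holds. *)
pose bw := if [pick i in Y] is Some i then ~~ b i else true.
have bwP i : addw -> i \in Y -> b i != bw.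
  move=> /wY[j YE]; rewrite /bw YE inE => /eqP ->.
  by case: pickP => [l|/(_ j)]; rewrite inE ?eqxx // => /eqP ->; case: (b j).
exists (fun z => match z with Some (inl i) | Some (inr i) => b i
                            | None => bw end), (Some (inl r)); split.
- by rewrite inE.
- move=> [[i|i]|] [[j|j]|]; rewrite !inE //= => zS tS zt.
  + exact: bP.
  + by apply: bP => //; apply: YS.
  + by apply: bP => //; apply: YS.
  + exact: bwP.
  + by rewrite eq_sym; apply: bwP.
- move=> [[i|i]|]; rewrite inE.
  + by move=> /nbr[j jS ij]; exists (Some (inl j)); rewrite ?inE.
  + by move=> /YS/nbr[j jS ij]; exists (Some (inl j)); rewrite ?inE.
  + by move=> /wY[i YE]; exists (Some (inr i)); rewrite ?inE ?YE ?inE.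
- move=> A Ar step.
  have Av i : i \in S -> A (Some (inl i)).
    apply: (ind (fun i => A (Some (inl i)))) => // x y xS yS Ax xy.
    by apply: (step (Some (inl x))); rewrite ?inE.
  have Au i : i \in Y -> A (Some (inr i)).
    (* [nbr] provides a vertex of [S] adjacent to the twin; connectedness alone would not, as [S]
       could be a single vertex. *)
    move=> iY; have [j jS ij] := nbr i (YS i iY).
    by apply: (step (Some (inl j))); rewrite ?inE //=; [exact: Av|rewrite adj_sym].
  move=> [[i|i]|]; rewrite inE => zS; [exact: Av|exact: Au|].
  have [i YE] := wY zS.
  have iY : i \in Y by rewrite YE inE.
  by apply: (step (Some (inr i))); rewrite ?inE //=; exact: Au.
Qed.

End TwinExtension.

(** Listing the colors, rather than counting them, lets the inductive step adjoin [c w] to a list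
    that avoids it. *)
Definition forces_colors (G : sgraph) (k : nat) : Prop :=
  forall c : G -> nat, proper_coloring c ->
  exists2 S : {set G}, connected_bipartite S &
  exists s : seq nat, [/\ uniq s, size s = k &
    forall a, a \in s -> exists2 x, x \in S & c x = a].

Lemma mycielskian_forces_colors (G : sgraph) (k : nat) :
  forces_colors G k -> forces_colors (mycielskian G) k.+1.
Proof.
move=> forceG c /proper_coloringP cP.
pose v i : mycielskian G := Some (inl i).
pose u i : mycielskian G := Some (inr i).
pose w : mycielskian G := None.
pose c' i := if c (v i) == c w then c (u i) else c (v i).
have c'w i : c' i != c w.
  by rewrite /c'; case: ifPn => // _; apply: cP.
(* Adjacent [i] and [j] are not both recolored, since [v i] and [v j] would share the color of [w].
   If only [i] is, the edge from [u i] to [v j] separates the new colors. *)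
have /forceG[S Sbip [s [us sk sS]]] : proper_coloring c'.
  apply/proper_coloringP => i j ij; rewrite /c'.
  case: ifP => [/eqP iw|_]; case: ifP => [/eqP jw|_]; try exact: cP.
  by have := cP (v i) (v j) ij; rewrite iw jw eqxx.
have wNs : c w \notin s.
  by apply/negP => /sS[i _ ci]; have := c'w i; rewrite ci eqxx.
pose X := [set i in S | c (v i) == c w].
(* If [X] is empty, [c'] is [c] on the copy of [S], and [w], attached through the twin of the root,
   brings [c w]. *)
have [X0|[i0]] := set_0Vmem X.
  have [b [r [rS _ _ _]]] := Sbip.
  exists (twin_extension S [set r] true).
    apply: twin_extension_connected_bipartite; rewrite ?sub1set //.
    by exists r.
  exists (c w :: s); rewrite /= wNs us sk; split=> // a.
  rewrite inE => /predU1P[->|/sS[i iS <-]]; first by exists w; rewrite ?inE.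
  exists (v i); rewrite ?inE // /c'; case: ifP => // iw.
  by have := in_set0 i; rewrite -X0 !inE iS iw.
(* Here [v i0] already has color [c w], and the twins of [X] bring the colors that [c'] uses on
   [X]. *)
rewrite inE => /andP[i0S /eqP i0w].
exists (twin_extension S X false).
  apply: twin_extension_connected_bipartite => //.
  by apply/subsetP => i; rewrite inE => /andP[].
exists (c w :: s); rewrite /= wNs us sk; split=> // a.
rewrite inE => /predU1P[->|/sS[i iS <-]]; first by exists (v i0); rewrite ?inE.
rewrite /c'; case: ifP => iw; last by exists (v i); rewrite ?inE.
by exists (u i) => //; rewrite inE /= inE iS iw.
Qed.

Lemma complete_graph2_forces_colors : forces_colors (complete_graph 2) 2.
Proof.
move=> c /proper_coloringP cP; pose x0 : 'I_2 := ord0; pose x1 : 'I_2 := ord_max.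
exists [set: 'I_2].
  exists (fun x : 'I_2 => x == x0), x0; split=> //.
  - by move=> [[|[|i]] ?] [[|[|j]] ?].
  - by move=> x _; exists (if x == x0 then x1 else x0) => //; case: x => [[|[|i]] ?].
  - move=> A A0 step x _; have [->//|xN0] := eqVneq x x0.
    by apply: (step x0); rewrite ?inE //= /complete_adj eq_sym.
exists [:: c x0; c x1]; split=> //; first by rewrite /= inE andbT; apply: cP.
by move=> a; rewrite !inE => /orP[] /eqP ->; [exists x0|exists x1].
Qed.

Lemma mycielski_graph_forces_colors (n : nat) :
  forces_colors (mycielski_graph n.+2) n.+2.
Proof.
rewrite /mycielski_graph !subSS subn0; elim: n => [|n IHn].
  exact: complete_graph2_forces_colors.
exact: mycielskian_forces_colors.
Qed.

Lemma phihat_ge_forces_colors (G : sgraph) (k : nat) :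
  forces_colors G k -> k - 2 <= phihat G.
Proof.
move=> force; apply: min_proper_ge => c /force[S Sbip [s [us <- sS]]].
apply: leq_trans (leq_sub (num_colors_ge us sS) (connected_bipartite_chi Sbip)) _.
apply: (@leq_bigmax_cond _ _ (fun S => num_colors c S - chi (induced S))).
exact: connected_bipartite_connected.
Qed.

Theorem theorem7p4 (k : nat) (hk : 2 <= k) :
  phi (mycielski_graph k) = phihat (mycielski_graph k) /\
  phihat (mycielski_graph k) = k - 2.
Proof.
case: k hk => [|[|n]] // _.
have [c /phi_le_tight phi_le] := mycielski_graph_tight n.
have phihat_ge := phihat_ge_forces_colors (@mycielski_graph_forces_colors n).
have phihat_le := phihat_le_phi (mycielski_graph n.+2).
have -> : phihat (mycielski_graph n.+2) = n.+2 - 2.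
  by apply/eqP; rewrite eqn_leq phihat_ge (leq_trans phihat_le).
by split=> //; apply/eqP; rewrite eqn_leq phi_le (leq_trans phihat_ge).
Qed.
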